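(* Let $X=(X_1,\dots,X_n):\Omega\to\mathbb{R}^n$ be an uncertain variable, $f:[\![X]\!]\to\mathbb{R}^q$ a query and $\mathfrak{M}:\mathbb{R}^q\to\mathbb{R}^q$ a mapping such that $\mathfrak{M}\circ f$ is $\epsilon$-noiselessly private, $\epsilon>0$. Let $i\in\{1,\dots,n\}$, let $x_i\neq x_i'$ be elements of $[\![X_i]\!]$, let $\overline{X}_i:\Omega\to\{x_i,x_i'\}$ be an uncertain variable with range $[\![\overline{X}_i]\!]=\{x_i,x_i'\}$, and let $\overline{X}=(X_{-i},\overline{X}_i)$ be $X$ with its $i$-th entry replaced by $\overline{X}_i$. Let $\psi_{i,v_{-i}}\in\Psi_i$ be arbitrary and set $Y=\mathfrak{M}\circ f\circ\psi_{i,v_{-i}}\circ\overline{X}$. Let the hypothesis $H$ be the uncertain variable with $H(\omega)=p_0$ if $\overline{X}_i(\omega)=x_i$ and $H(\omega)=p_1$ if $\overline{X}_i(\omega)=x_i'$. Then for every test $T:[\![Y]\!]\to\{p_0,p_1\}$, the performance of the test satisfies $$\mathcal{P}(T)\le\epsilon .$$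
   Context: An uncertain variable is a map on a nonempty set $\Omega$ (no measure assumed). Range: $[\![X]\!]=\{X(\omega):\omega\in\Omega\}$. Conditional range: for a set $\mathcal{Y}\subseteq[\![Y]\!]$, $[\![X|\mathcal{Y}]\!]=\{X(\omega):\omega\in\Omega,\ Y(\omega)\in\mathcal{Y}\}$, and $[\![X|y]\!]=[\![X|\{y\}]\!]$. For $x\in\mathbb{R}^n$, $x_{-i}$ is the vector with $i$-th entry removed; similarly $X_{-i}$. $\mathfrak{M}\circ f$ is $\epsilon$-noiselessly private if, with $Z=\mathfrak{M}\circ f\circ X$, the set $\{Z(\omega):\omega\in\Omega,\ X_{-i}(\omega)=x_{-i}\}$ has at most $2^\epsilon$ elements for all $i$ and all $x_{-i}\in[\![X_{-i}]\!]$. For $v_{-i}\in[\![X_{-i}]\!]$, $\psi_{i,v_{-i}}(x)=(v_1,\dots,v_{i-1},x_i,v_{i+1},\dots,v_n)$, and $\Psi_i=\{\psi_{i,v_{-i}}:v_{-i}\in[\![X_{-i}]\!]\}$. It is understood that $[\![X]\!]$ contains every vector with $i$-th entry in $[\![X_i]\!]$ and remaining entries $v_{-i}\in[\![X_{-i}]\!]$, so that $f\circ\psi_{i,v_{-i}}$ is defined. Performance of a test. A test $T:[\![Y]\!]\to\{p_0,p_1\}$ is correct at $y\in[\![Y]\!]$ if $[\![H|[\![\overline{X}|y]\!]]\!]=\{T(y)\}$, i.e. every $\omega$ with $\overline{X}(\omega)\in[\![\overline{X}|y]\!]$ has $H(\omega)=T(y)$. Let $\aleph(T)\subseteq[\![Y]\!]$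 be the set of $y$ at which $T$ is correct. Since $Y$ is discrete, the performance is $\mathcal{P}(T)=\log_2|\aleph(T)|$ (with $\log_2 0=-\infty$). *)

(* Defs.v *)
From HB Require Import structures.
From mathcomp Require Import all_boot all_order all_algebra.
From mathcomp Require Import all_classical all_reals all_analysis.

Set Implicit Arguments.
Unset Strict Implicit.
Unset Printing Implicit Defensive.

Import Order.TTheory GRing.Theory Num.Theory.

Local Open Scope classical_set_scope.
Local Open Scope ring_scope.

(* An uncertain variable is an arbitrary map [X : Omega -> S]; its range [[X]]
   is [range X].  The conditional range [[X | B]] : *)
Definition cond_range (Omega S U : Type) (X : Omega -> S) (Y : Omega -> U)
  (B : set U) : set S := X @` (Y @^-1` B).

Definition to_set (Omega S : Type) (A : set S) (g : Omega -> S)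
  (gA : forall w, A (g w)) : Omega -> A := fun w => SigSub (mem_set (gA w)).

Definition to_range (Omega S : Type) (X : Omega -> S) : Omega -> range X :=
  to_set (imageT X).

(* X_i *)
Definition entry (R Omega : Type) (n : nat) (X : Omega -> 'rV[R]_n) (i : 'I_n)
  : Omega -> R := fun w => X w ord0 i.

(* X_{-i} *)
Definition others (R Omega : Type) (n : nat) (X : Omega -> 'rV[R]_n) (i : 'I_n)
  : Omega -> 'rV[R]_n.-1 := fun w => col' i (X w).

(* The vector with i-th entry a and remaining entries v, i.e.
   (v_1, ..., v_{i-1}, a, v_{i+1}, ..., v_n) : [unlift i j] is [None] when
   [j = i], and otherwise [Some] of the position of j once i is removed. *)
Definition insert (R : Type) (n : nat) (i : 'I_n) (a : R) (v : 'rV[R]_n.-1)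
  : 'rV[R]_n :=
  \row_j (if unlift i j is Some k then v ord0 k else a).

Definition psi (R : Type) (n : nat) (i : 'I_n) (v : 'rV[R]_n.-1)
  : 'rV[R]_n -> 'rV[R]_n := fun x => insert i (x ord0 i) v.

Definition Psi (R Omega : Type) (n : nat) (X : Omega -> 'rV[R]_n) (i : 'I_n)
  : set ('rV[R]_n -> 'rV[R]_n) := [set psi i v | v in range (others X i)].

(* [X] with its i-th entry replaced by [Xi]. *)
Definition replace (R Omega : Type) (n : nat) (X : Omega -> 'rV[R]_n)
  (i : 'I_n) (Xi : Omega -> R) : Omega -> 'rV[R]_n :=
  fun w => insert i (Xi w) (others X i w).

(* The standing assumption on [[X]] under which f \o psi_{i,v} is defined. *)
Definition range_closed_at (R Omega : Type) (n : nat) (X : Omega -> 'rV[R]_n)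
  (i : 'I_n) : Prop :=
  forall (a : R) (v : 'rV[R]_n.-1),
    range (entry X i) a -> range (others X i) v -> range X (insert i a v).

(* A query is only defined on [[X]], hence its domain [range X]. [counting] is
   the cardinality of a set (+oo if it is infinite). *)
Definition noiselessly_private (R : realType) (Omega : Type) (n q : nat)
  (X : Omega -> 'rV[R]_n) (f : range X -> 'rV[R]_q)
  (M : 'rV[R]_q -> 'rV[R]_q) (eps : R) : Prop :=
  forall (i : 'I_n) (v : 'rV[R]_n.-1), range (others X i) v ->
    (counting (cond_range (M \o f \o @to_range _ _ X) (others X i) [set v])
       <= (2 `^ eps)%:E)%E.

Lemma psi_replace_range (R Omega : Type) (n : nat) (X : Omega -> 'rV[R]_n)
  (i : 'I_n) (x x' : R) (Xi : Omega -> R) (g : 'rV[R]_n -> 'rV[R]_n) :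
  range_closed_at X i -> range (entry X i) x -> range (entry X i) x' ->
  range Xi = [set x; x'] -> Psi X i g ->
  forall w, range X ((g \o replace X i Xi) w).
Proof.
move=> hX hx hx' hXi [v hv <-] w; apply: hX => //.
rewrite /replace mxE unlift_none.
by have : range Xi (Xi w) by []; rewrite hXi => -[->|->].
Qed.

Inductive outcome : Set := p0 | p1.

Section Test.
Variables (R : realType) (Omega A : Type) (B : choiceType).
Variables (H : Omega -> outcome) (Xbar : Omega -> A) (Y : Omega -> B).

Definition correct_at (T : range Y -> outcome) (y : range Y) : Prop :=
  cond_range H Xbar (cond_range Xbar Y [set val y]) = [set T y].

Definition aleph (T : range Y -> outcome) : set (range Y) :=
  [set y | correct_at T y].

(* log_2 of the cardinality of [aleph T]; [lne 0] is -oo. *)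
Definition performance (T : range Y -> outcome) : \bar R :=
  (lne (counting (aleph T)) * ((ln 2)^-1)%:E)%E.

End Test.
Arguments performance R {Omega A B} H Xbar {Y} T.

(* Main.v *)
(* The map psi_{i,v} resets every entry but the i-th to v, so each value of Y is
   an output of M \o f on a database whose remaining entries are v; by privacy
   there are at most 2^eps of these.  The points at which T is correct form a
   subset of the range of Y, whatever T is. *)

Require Import Defs.
From HB Require Import structures.
From mathcomp Require Import all_boot all_order all_algebra.
From mathcomp Require Import all_classical all_reals all_analysis.

Set Implicit Arguments.
Unset Strict Implicit.
Unset Printing Implicit Defensive.

Import Order.TTheory GRing.Theory Num.Theory.

Local Open Scope classical_set_scope.
Local Open Scope ring_scope.

Lemma counting_ge0 (T : choiceType) (R : realType) (A : set T) :
  (0 <= counting A :> \bar R)%E.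
Proof. by rewrite /counting; case: ifPn; rewrite ?lee_fin ?leey. Qed.

(** If [B] is infinite, the right side is [+oo]; otherwise [A] is finite too and both sides are
    natural numbers. *)
Lemma le_counting_card (T U : choiceType) (R : realType) (A : set T)
  (B : set U) : (A #<= B)%card -> (counting A <= counting B :> \bar R)%E.
Proof.
move=> AB; rewrite /counting; have [finB|infB] := pselect (finite_set B).
  rewrite !asboolT//; last exact: card_le_finite AB finB.
  have /finite_setP[m Bm] := finB.
  rewrite lee_fin ler_nat (card_fset_set Bm); apply: geq_card_fset_set.
  by rewrite -(card_le_eqr Bm).
by rewrite [X in (_ <= X)%E]ifF ?leey//; apply/asboolPn.
Qed.

(** Clearing [ln 2 > 0] leaves monotonicity of [lne] on [[0, +oo]]. Taking [c] in [\bar R] covers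
    the value [-oo] of the logarithm at [c = 0]. *)
Lemma le_log2_powR (R : realType) (c : \bar R) (e : R) :
  (0 <= c)%E -> (c <= (2 `^ e)%:E)%E -> (lne c * ((ln 2)^-1)%:E <= e%:E)%E.
Proof.
move=> c0 ce; have ln2 : (0 : R) < ln 2 by rewrite ln_gt0// ltr1n.
have pow0 : (0 : R) < 2 `^ e by rewrite powR_gt0.
rewrite lee_pdivrMr// -EFinM -ln_powR -lne_EFin// lee_lne// in_itv/= leey andbT//.
Qed.

Lemma others_insert (K Omega : Type) (n : nat) (X : Omega -> 'rV[K]_n)
  (i : 'I_n) (a : K) (v : 'rV[K]_n.-1) (w : Omega) :
  X w = insert i a v -> others X i w = v.
Proof.
by move=> Xw; apply/rowP => k; rewrite /others Xw !mxE liftK.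
Qed.

Theorem theorem3 (R : realType) (Omega : Type) (Omega_neq0 : [set: Omega] !=set0)
  (n q : nat) (X : Omega -> 'rV[R]_n)
  (f : range X -> 'rV[R]_q) (M : 'rV[R]_q -> 'rV[R]_q)
  (eps : R) (eps_gt0 : 0 < eps)
  (priv : noiselessly_private f M eps)
  (i : 'I_n) (X_closed : range_closed_at X i)
  (x x' : R) (hx : range (entry X i) x) (hx' : range (entry X i) x')
  (x_neq : x <> x')
  (Xbar_i : Omega -> R) (range_Xbar_i : range Xbar_i = [set x; x'])
  (g : 'rV[R]_n -> 'rV[R]_n) (g_Psi : Psi X i g)
  (H : Omega -> outcome)
  (H0 : forall w, Xbar_i w = x -> H w = p0)
  (H1 : forall w, Xbar_i w = x' -> H w = p1) :
  let Xbar : Omega -> 'rV[R]_n := replace X i Xbar_i in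
  let g_Xbar : Omega -> range X :=
    to_set (psi_replace_range X_closed hx hx' range_Xbar_i g_Psi) in
  let Y : Omega -> 'rV[R]_q := M \o f \o g_Xbar in
  forall T : range Y -> outcome, (performance R H Xbar T <= eps%:E)%E.
Proof.
move=> Xbar g_Xbar Y T; apply: le_log2_powR; first exact: counting_ge0.
have [v hv gE] := g_Psi.
apply: (le_trans _ (priv i v hv)); apply: le_counting_card.
(* Passing to the image under the injective [val] keeps the cardinality and puts both sets in
   ['rV[R]_q], where inclusion makes sense. *)
rewrite -(card_le_eql (inj_card_eq (in2W val_inj))).
apply: subset_card_le => _ [y _ <-].
have [w _ <-] := set_mem (valP y).
(* The other entries of [X w] may differ from [v], so [w] is no witness; [w'] is a sample point
   where [X] equals [g (Xbar w)]. *)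
have [w' _ Xw'] := set_mem (valP (g_Xbar w)).
exists w'.
  by apply: (@others_insert _ _ _ _ _ (Xbar w ord0 i)); rewrite Xw' /= -gE.
(* The two arguments of [f] are the same vector with different proofs of membership in [range X]. *)
by rewrite /Y /=; congr (M (f _)); apply: val_inj.
Qed.
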